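(* For each positive integer $d$, let $C_R(d)$ be the sharp constant in the discrete Rellich inequality $$\sum_{n \in \mathbb{Z}^d} |\Delta u(n)|^2 \geq C_R(d) \sum_{n \in \mathbb{Z}^d} \frac{|u(n)|^2}{|n|^{4}},\qquad u \in C_c(\mathbb{Z}^d),\ u(0)=0,$$ i.e. the largest constant for which this inequality holds for all $u\in C_c(\mathbb{Z}^d)$ with $u(0)=0$. Then $C_R(d) \sim d^2$ as $d \to \infty$; that is, there exist positive constants $c_1, c_2$ and $N$, independent of $d$, such that $c_1 d^2\leq C_R(d) \leq c_2 d^2$ for all $d\geq N$.
   Context: $C_c(\mathbb{Z}^d)$ denotes the space of finitely supported (complex-valued) functions on $\mathbb{Z}^d$; $|n|$ is the Euclidean norm of $n \in \mathbb{Z}^d$; $e_j$ is the $j$-th canonical basis vector of $\mathbb{R}^d$. The discrete Laplacian is $\Delta u(n) := \sum_{j=1}^d \big(2u(n)-u(n-e_j)-u(n+e_j)\big)$. Since $u(0)=0$, the term $n=0$ in the sum weighted by $|n|^{-4}$ is understood to be $0$. *)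

(* Defs.v *)
From mathcomp Require Import all_boot all_order all_algebra.
From mathcomp Require Import all_classical all_reals.
From mathcomp Require Import complex.

Set Implicit Arguments.
Unset Strict Implicit.
Unset Printing Implicit Defensive.

Import Order.TTheory GRing.Theory Num.Theory.
Import ComplexField.Normc.

Local Open Scope classical_set_scope.
Local Open Scope ring_scope.

Notation lattice d := ('rV[int]_d).

Definition lattice_unit d (j : 'I_d) : lattice d := delta_mx 0 j.

Definition lattice_norm (R : realType) d (n : lattice d) : R :=
  Num.sqrt (\sum_(j < d) (n 0 j)%:~R ^+ 2).

Definition finitely_supported (R : realType) d (u : lattice d -> R[i]) : Prop :=
  finite_set [set n | u n != 0].

Definition discrete_laplacian (R : realType) d (u : lattice d -> R[i])
    (n : lattice d) : R[i] :=
  \sum_(j < d) (2 * u n - u (n - lattice_unit j) - u (n + lattice_unit j)).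

(* The sums over the whole lattice are finitely supported sums; see
   [finite_rellich_energy] and [finite_rellich_weight]. *)
Definition rellich_energy (R : realType) d (u : lattice d -> R[i]) : R :=
  \sum_(n \in [set: lattice d]) normc (discrete_laplacian u n) ^+ 2.

(* The term at n = 0 is 0, since 0^-1 = 0. *)
Definition rellich_weighted_sum (R : realType) d (u : lattice d -> R[i]) : R :=
  \sum_(n \in [set: lattice d]) normc (u n) ^+ 2 / lattice_norm R n ^+ 4.

Definition rellich_admissible (R : realType) d : set R :=
  [set c | forall u : lattice d -> R[i], finitely_supported u -> u 0 = 0 ->
     c * rellich_weighted_sum u <= rellich_energy u].

(* For 0 < d the supremum is a maximum: see [rellich_constant_max]. *)
Definition rellich_constant (R : realType) d : R :=
  sup (@rellich_admissible R d).

Lemma finite_rellich_energy (R : realType) d (u : lattice d -> R[i]) :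
  finitely_supported u ->
  finite_set [set n | normc (discrete_laplacian u n) ^+ 2 != 0].
Proof.
move=> fu; pose S := [set n : lattice d | u n != 0].
pose T := S `|` \bigcup_(j in [set: 'I_d])
  ([set n + lattice_unit j | n in S] `|` [set n - lattice_unit j | n in S]).
have fT : finite_set T.
  rewrite finite_setU; split => //; apply: bigcup_finite => // j _.
  by rewrite finite_setU; split; apply: finite_image.
apply: sub_finite_set fT => n /= Dn.
apply: contrapT => nT; move/negP: Dn; apply; apply/eqP.
rewrite /discrete_laplacian big1 ?normc0 ?expr0n// => j _.
have u0 m : ~ S m -> u m = 0.
  by move=> nS; apply/eqP; apply: contrapT => /negP.
rewrite !u0 ?mulr0 ?subr0 //.
- move=> Sn; apply: nT; right; exists j => //; right.
  by exists (n + lattice_unit j) => //; rewrite addrK.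
- move=> Sn; apply: nT; right; exists j => //; left.
  by exists (n - lattice_unit j) => //; rewrite subrK.
- by move=> Sn; apply: nT; left.
Qed.

Lemma finite_rellich_weight (R : realType) d (u : lattice d -> R[i]) :
  finitely_supported u ->
  finite_set [set n | normc (u n) ^+ 2 / lattice_norm R n ^+ 4 != 0].
Proof.
apply: sub_finite_set => n /=; apply: contra_neq => ->.
by rewrite normc0 expr0n mul0r.
Qed.

Lemma rellich_energy_ge0 (R : realType) d (u : lattice d -> R[i]) :
  0 <= rellich_energy u.
Proof. by apply: fsumr_ge0 => n _; exact: sqr_ge0. Qed.

Lemma rellich_weighted_sum_ge0 (R : realType) d (u : lattice d -> R[i]) :
  0 <= rellich_weighted_sum u.
Proof.
apply: fsumr_ge0 => n _; rewrite divr_ge0 ?sqr_ge0// exprn_ge0//.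
exact: sqrtr_ge0.
Qed.

Lemma rellich_constant_max (R : realType) d : (0 < d)%N ->
  rellich_admissible d (rellich_constant R d) /\
  forall c, rellich_admissible d c -> c <= rellich_constant R d.
Proof.
move=> d0; pose j0 : 'I_d := Ordinal d0.
pose v : lattice d -> R[i] := fun n => (n == lattice_unit j0)%:R.
have e0 : lattice_unit j0 != 0.
  apply/eqP => /matrixP /(_ 0 j0) /eqP.
  by rewrite !mxE !eqxx oner_eq0.
have fv : finitely_supported v.
  apply: (@sub_finite_set _ _ [set lattice_unit j0]) => // n /=.
  by apply: contra_neqP => /eqP/negPf nj; rewrite /v nj.
have v0 : v 0 = 0 by rewrite /v eq_sym (negPf e0).
have sv : rellich_weighted_sum v = 1.
  rewrite /rellich_weighted_sum -(fsbig_widen [set lattice_unit j0]) //.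
    rewrite fsbig_set1 /v eqxx normc1 /lattice_norm (bigD1 j0) //= big1.
      by rewrite /lattice_unit mxE !eqxx addr0 !expr1n sqrtr1 expr1n divr1.
    by move=> i /negPf ij; rewrite /lattice_unit mxE eqxx ij expr0n.
  move=> n [_ /= /eqP nj]; rewrite /v (negPf nj) normc0 expr0n mul0r //.
have hs : has_sup (@rellich_admissible R d).
  split.
    by exists 0 => u _ _; rewrite mul0r; exact: rellich_energy_ge0.
  exists (rellich_energy v) => c /(_ v fv v0).
  by rewrite sv mulr1.
split=> [u fu u0|c hc]; last by apply: ub_le_sup => //; case: hs.
have [w0|w0] := eqVneq (rellich_weighted_sum u) 0.
  by rewrite w0 mulr0 rellich_energy_ge0.
have wp : 0 < rellich_weighted_sum u.
  by rewrite lt_def w0 rellich_weighted_sum_ge0.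
rewrite -ler_pdivlMr//; apply: ge_sup; first by case: hs.
by move=> c hc; rewrite ler_pdivlMr//; exact: hc.
Qed.

(* Main.v *)
Require Import Defs.
From mathcomp Require Import all_boot all_order all_algebra.
From mathcomp Require Import all_classical all_reals.
From mathcomp Require Import finmap complex.
From mathcomp Require Import zify ring lra.

Import Order.TTheory GRing.Theory Num.Theory.
Import ComplexField.Normc.
Local Open Scope ring_scope.

(** The lower bound comes from testing the Laplacian against u / |n|^2. Put
    w(n) = |n|^-2 and f = |u|^2. Expanding squares along the edges gives the pointwise bound
    2 Re(conj(u) Delta u) >= Delta f, so that for every t >= 0

      |Delta u|^2 >= 2 t w Re(conj(u) Delta u) - t^2 w^2 |u|^2
                  >= t w Delta f - t^2 w^2 f

    ([sqr_normc_laplacian_ge]). Summing over the lattice and moving the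
    Laplacian onto w ([laplacian_self_adjoint]) bounds the energy from below
    by the sum of (t Delta w - t^2 w^2) f. In the continuum the positive
    Laplacian of |x|^-2 is 2 (d - 4) |x|^-4; on the lattice
    [laplacian_weight_ge] gives Delta w >= (d/2) w^2 away from the origin as
    soon as d >= 32, and the origin itself does not count because f vanishes
    there. The energy is thus at least (t d/2 - t^2) times the weighted sum,
    and the optimal t = d/4 yields the constant d^2/16.

    The upper bound expresses that the Laplacian is a sum of d second
    differences, each of norm at most 4, so that the energy is at most
    (4 d)^2 times the squared l^2 norm ([rellich_energy_le]). For the indicator
    function of a basis vector both the squared l^2 norm and the weighted sum
    equal 1, hence the constant is at most 16 d^2. *)

(** * Pointwise bounds on the Laplacian *)

(** The real analogue of [discrete_laplacian]: it acts on the real and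
    imaginary parts of a function, on its squared modulus, and on the weight. *)
Definition laplacian {R : realType} {d} (f : lattice d -> R) (n : lattice d) : R :=
  \sum_(j < d) (2 * f n - f (n - lattice_unit j) - f (n + lattice_unit j)).

Lemma normc_sqr {R : realType} (z : R[i]) :
  normc z ^+ 2 = complex.Re z ^+ 2 + complex.Im z ^+ 2.
Proof. by case: z => a b /=; rewrite sqr_sqrtr ?addr_ge0 ?sqr_ge0. Qed.

Lemma Re_discrete_laplacian {R : realType} {d} (u : lattice d -> R[i]) n :
  complex.Re (discrete_laplacian u n) = laplacian (fun m => complex.Re (u m)) n.
Proof.
rewrite /discrete_laplacian /laplacian.
elim/big_rec2: _ => // j x y _ <-; rewrite [2 * u n]mulr_natl mulr2n.
case: y => ? ?; case: (u n) => a b; case: (u _) => a' b'; case: (u _) => a'' b''.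
by rewrite /=; ring.
Qed.

Lemma Im_discrete_laplacian {R : realType} {d} (u : lattice d -> R[i]) n :
  complex.Im (discrete_laplacian u n) = laplacian (fun m => complex.Im (u m)) n.
Proof.
rewrite /discrete_laplacian /laplacian.
elim/big_rec2: _ => // j x y _ <-; rewrite [2 * u n]mulr_natl mulr2n.
case: y => ? ?; case: (u n) => a b; case: (u _) => a' b'; case: (u _) => a'' b''.
by rewrite /=; ring.
Qed.

Lemma laplacianD {R : realType} {d} (f g : lattice d -> R) n :
  laplacian (fun m => f m + g m) n = laplacian f n + laplacian g n.
Proof. by rewrite /laplacian -big_split; apply: eq_bigr => j _ /=; ring. Qed.

(** The difference of the two sides is the sum of (f(n) - f(m))^2 over the
    neighbours m of n. *)
Lemma laplacian_sqr_le {R : realType} {d} (f : lattice d -> R) n :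
  laplacian (fun m => f m ^+ 2) n <= 2 * f n * laplacian f n.
Proof.
rewrite /laplacian mulr_sumr; apply: ler_sum => j _; rewrite -subr_ge0.
set a := f n; set b := f _; set c := f _.
rewrite (_ : _ - _ = (a - b) ^+ 2 + (a - c) ^+ 2); last by ring.
by rewrite addr_ge0 ?sqr_ge0.
Qed.

(** Young's inequality L^2 >= 2 s f L - s^2 f^2 for L the Laplacian of f,
    followed by [laplacian_sqr_le]; the parameter s will depend on n. *)
Lemma sqr_laplacian_ge {R : realType} {d} (f : lattice d -> R) (s : R) n : 0 <= s ->
  s * laplacian (fun m => f m ^+ 2) n - s ^+ 2 * f n ^+ 2 <= laplacian f n ^+ 2.
Proof.
move=> s0.
have h := ler_wpM2l s0 (laplacian_sqr_le f n).
have := sqr_ge0 (laplacian f n - s * f n); rewrite sqrrB exprMn.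
lra.
Qed.

Lemma sqr_normc_laplacian_ge {R : realType} {d} (u : lattice d -> R[i]) (s : R) n :
  0 <= s ->
  s * laplacian (fun m => normc (u m) ^+ 2) n - s ^+ 2 * normc (u n) ^+ 2
    <= normc (discrete_laplacian u n) ^+ 2.
Proof.
move=> s0; under [fun m => _]funext do rewrite normc_sqr.
rewrite laplacianD !normc_sqr Re_discrete_laplacian Im_discrete_laplacian.
have := lerD (sqr_laplacian_ge (fun m => complex.Re (u m)) s n s0)
             (sqr_laplacian_ge (fun m => complex.Im (u m)) s n s0).
lra.
Qed.

(** Cauchy-Schwarz against the constant 1, by expanding the square and using
    x_i x_j <= (x_i^2 + x_j^2) / 2. *)
Lemma sqr_sum_le {R : realFieldType} {I : finType} (x : I -> R) :
  (\sum_j x j) ^+ 2 <= #|I|%:R * \sum_j x j ^+ 2.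
Proof.
have -> : (\sum_j x j) ^+ 2 = \sum_i \sum_j x i * x j.
  by rewrite expr2 mulr_suml; apply: eq_bigr => i _; rewrite mulr_sumr.
apply: (@le_trans _ _ (\sum_i \sum_j (x i ^+ 2 / 2 + x j ^+ 2 / 2))).
  apply: ler_sum => i _; apply: ler_sum => j _.
  have := sqr_ge0 (x i - x j); rewrite sqrrB; lra.
under eq_bigr do rewrite big_split sumr_const /=.
rewrite big_split sumr_const sumrMnl -!mulr_suml /= mulr_natl.
lra.
Qed.

(** Cauchy-Schwarz over the d directions, and (2a - b - c)^2 <= 4 (2a^2 + b^2 +
    c^2) in each of them; the weights 2, 1, 1 are the ones that give the sharp
    norm 4 of a second difference. *)
Lemma sqr_laplacian_le {R : realType} {d} (f : lattice d -> R) n :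
  laplacian f n ^+ 2 <= 4 * d%:R * \sum_(j < d)
    (2 * f n ^+ 2 + f (n - lattice_unit j) ^+ 2 + f (n + lattice_unit j) ^+ 2).
Proof.
apply: le_trans (sqr_sum_le _) _; rewrite card_ord [4 * _]mulrC -mulrA.
apply: ler_wpM2l; first exact: ler0n.
rewrite mulr_sumr; apply: ler_sum => j _.
set a := f n; set b := f _; set c := f _; rewrite -subr_ge0.
rewrite (_ : _ - _ = 2 * ((a + b) ^+ 2 + (a + c) ^+ 2) + (b - c) ^+ 2); last by ring.
have := sqr_ge0 (a + b); have := sqr_ge0 (a + c); have := sqr_ge0 (b - c); lra.
Qed.

Lemma sqr_normc_laplacian_le {R : realType} {d} (u : lattice d -> R[i]) n :
  normc (discrete_laplacian u n) ^+ 2 <= 4 * d%:R * \sum_(j < d)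
    (2 * normc (u n) ^+ 2 + normc (u (n - lattice_unit j)) ^+ 2
     + normc (u (n + lattice_unit j)) ^+ 2).
Proof.
rewrite normc_sqr Re_discrete_laplacian Im_discrete_laplacian.
apply: le_trans (lerD (sqr_laplacian_le _ _) (sqr_laplacian_le _ _)) _.
rewrite -mulrDr -big_split /= le_eqVlt; apply/orP; left; apply/eqP.
by congr (_ * _); apply: eq_bigr => j _; rewrite !normc_sqr; ring.
Qed.

(** * Summation by parts on the lattice *)

(** Outside such a set A, a function supported in S and its Laplacian both
    vanish, so that every sum over the lattice becomes a sum over A. *)
Definition neighbours_in {d} (S : set (lattice d)) (A : {fset lattice d}) : Prop :=
  forall n, S n -> n \in A /\
    forall j, n + lattice_unit j \in A /\ n - lattice_unit j \in A.

Lemma neighbours_in_fset {d} (S : set (lattice d)) :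
  finite_set S -> exists A, neighbours_in S A.
Proof.
move=> fS; pose T := (S `|` \bigcup_(j in [set: 'I_d])
  ([set n + lattice_unit j | n in S] `|` [set n - lattice_unit j | n in S]))%classic.
have fT : finite_set T.
  rewrite finite_setU; split => //; apply: bigcup_finite => // j _.
  by rewrite finite_setU; split; apply: finite_image.
exists (fset_set T) => n Sn; split=> [|j].
  by rewrite in_fset_set //; apply/mem_set; left.
by split; rewrite in_fset_set //; apply/mem_set; right; exists j => //;
  [left | right]; exists n.
Qed.

(** Both sums are equal to a sum over the whole lattice, which is invariant
    under translation by e. *)
Lemma sum_shift {R : realType} {d} (A : {fset lattice d}) (f w : lattice d -> R) e :
  (forall n, f n != 0 -> n \in A /\ n - e \in A) ->
  \sum_(n <- A) w n * f (n + e) = \sum_(n <- A) w (n - e) * f n.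
Proof.
move=> fA; have f0 n : ~ (n \in A /\ n - e \in A) -> f n = 0.
  by move=> nA; apply: contra_notP nA => /eqP/fA.
transitivity (\sum_(n \in [set: lattice d]) w n * f (n + e)).
  rewrite (@fsbigTE _ _ _ _ A) // => n /negP nA.
  by rewrite f0 ?mulr0 // addrK => -[].
rewrite (reindex_fsbigT (fun n => n - e)); last first.
  by exists (fun n => n + e) => n; rewrite ?subrK ?addrK.
rewrite (@fsbigTE _ _ _ _ A) => [|n /negP nA].
  by apply: eq_bigr => n _; rewrite subrK.
by rewrite subrK f0 ?mulr0 // => -[].
Qed.

Lemma sum_shifts {R : realType} {d} (A : {fset lattice d}) (f w : lattice d -> R) j :
  neighbours_in [set n | f n != 0] A ->
  \sum_(n <- A) w n * f (n + lattice_unit j)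
     = \sum_(n <- A) w (n - lattice_unit j) * f n /\
  \sum_(n <- A) w n * f (n - lattice_unit j)
     = \sum_(n <- A) w (n + lattice_unit j) * f n.
Proof.
move=> fA; split; first by apply: sum_shift => n /fA[nA /(_ j)[]].
rewrite (@sum_shift R d A f w (- lattice_unit j)).
  by under eq_bigr do rewrite opprK.
by move=> n /fA[nA /(_ j)[]]; rewrite opprK.
Qed.

Lemma laplacian_self_adjoint {R : realType} {d}
    (A : {fset lattice d}) (f w : lattice d -> R) :
  neighbours_in [set n | f n != 0] A ->
  \sum_(n <- A) w n * laplacian f n = \sum_(n <- A) laplacian w n * f n.
Proof.
move=> fA; rewrite /laplacian.
under eq_bigr do rewrite mulr_sumr.
under [RHS]eq_bigr do rewrite mulr_suml.
rewrite exchange_big [RHS]exchange_big /=; apply: eq_bigr => j _.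
have [sp sm] := sum_shifts A f w j fA.
under eq_bigr do rewrite !mulrBr; rewrite !sumrB sp sm.
under [RHS]eq_bigr do rewrite !mulrBl; rewrite !sumrB addrAC.
by congr (_ - _ - _); apply: eq_bigr => n _; ring.
Qed.

(** * The Laplacian of the weight *)

(** The contribution of one coordinate direction to the Laplacian of |n|^-2,
    where r = |n|^2 and x is the coordinate of n. With s = r + 1 it equals, for
    r >= 2, 2 / (r s) - 8 x^2 / (s (s^2 - 4 x^2)), where
    s^2 - 4 x^2 >= (r - 1)^2 >= r^2 / 4. The case r = 1 uses that x is an
    integer: for x = 1 or -1 one neighbour is the origin, where the weight is
    0^-1 = 0. The losses 32 x^2 / (r^2 s) add up to 32 / (r s) over
    all the coordinates, since the x^2 add up to r. *)
Lemma weight_second_difference {R : realType} (r x : int) :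
  1 <= r -> x ^+ 2 <= r ->
  2 / (r%:~R * (r%:~R + 1)) - 32 * x%:~R ^+ 2 / (r%:~R ^+ 2 * (r%:~R + 1))
   <= 2 / r%:~R - (r - 2 * x + 1)%:~R^-1 - (r + 2 * x + 1)%:~R^-1 :> R.
Proof.
move=> r1 xr; have [r2|r2] := leP 2 r; last first.
  have er : r = 1 by lia.
  have e2 : 1 + 1 = 2 :> R by [].
  have : (x = 0 \/ x = 1 \/ x = -1) by rewrite er in xr; nia.
  case=> [x0|[x0|x0]].
  - have [-> ->] : r - 2 * x + 1 = 2%:Z /\ r + 2 * x + 1 = 2%:Z by lia.
    by rewrite er x0 expr1n !mul1r e2 -!pmulrn; lra.
  - have [-> ->] : r - 2 * x + 1 = 0%:Z /\ r + 2 * x + 1 = 4%:Z by lia.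
    by rewrite er x0 expr1n !mul1r e2 invr0 -!pmulrn; lra.
  - have [-> ->] : r - 2 * x + 1 = 4%:Z /\ r + 2 * x + 1 = 0%:Z by lia.
    by rewrite er x0 expr1n !mul1r e2 invr0 -!pmulrn; lra.
rewrite !intrD intrN !intrM.
have {r1 r2} : 2 <= r%:~R :> R by rewrite (ler_int _ 2).
have {xr} : x%:~R ^+ 2 <= r%:~R :> R by rewrite -rmorphXn ler_int.
move: (r%:~R : R) (x%:~R : R) => {}r {}x xr r2.
have r0 : 0 < r by lra.
have q4 : r ^+ 2 / 4 <= (r + 1) ^+ 2 - 4 * x ^+ 2.
  have := mulr_ge0 (_ : 0 <= r - 2) (_ : 0 <= r); nra.
have q0 : 0 < (r + 1) ^+ 2 - 4 * x ^+ 2.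
  by apply: lt_le_trans q4; rewrite divr_gt0 ?exprn_gt0.
have ab : (r - 2 * x + 1) * (r + 2 * x + 1) = (r + 1) ^+ 2 - 4 * x ^+ 2 by ring.
have a0 : r - 2 * x + 1 != 0 by apply: contraTneq q0 => a; rewrite -ab a mul0r ltxx.
have b0 : r + 2 * x + 1 != 0 by apply: contraTneq q0 => b; rewrite -ab b mulr0 ltxx.
have -> : 2 / r - (r - 2 * x + 1)^-1 - (r + 2 * x + 1)^-1
    = 2 / (r * (r + 1)) - 8 * x ^+ 2 / (r + 1) * ((r + 1) ^+ 2 - 4 * x ^+ 2)^-1.
  by rewrite -ab; field; rewrite a0 b0 !gt_eqF //; lra.
rewrite lerD2l lerN2.
have -> : 32 * x ^+ 2 / (r ^+ 2 * (r + 1)) = 8 * x ^+ 2 / (r + 1) * (r ^+ 2 / 4)^-1.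
  by field; rewrite !gt_eqF //; lra.
apply: ler_wpM2l.
  by apply: divr_ge0; [rewrite mulr_ge0 ?sqr_ge0 ?ler0n | lra].
by rewrite lef_pV2 ?posrE // divr_gt0 ?exprn_gt0.
Qed.

Definition sqr_norm {d} (n : lattice d) : int := \sum_(j < d) n 0 j ^+ 2.

Lemma lattice_norm_sqr {R : realType} {d} (n : lattice d) :
  lattice_norm R n ^+ 2 = (sqr_norm n)%:~R.
Proof.
rewrite /lattice_norm /sqr_norm sqr_sqrtr ?sumr_ge0 // => [|j _]; last exact: sqr_ge0.
by rewrite rmorph_sum; apply: eq_bigr => j _; rewrite rmorphXn.
Qed.

Lemma sqr_normD {d} (n m : lattice d) :
  sqr_norm (n + m) = sqr_norm n + 2 * (\sum_(j < d) n 0 j * m 0 j) + sqr_norm m.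
Proof.
rewrite /sqr_norm mulr_sumr -!big_split; apply: eq_bigr => j _.
by rewrite mxE /=; ring.
Qed.

Lemma sqr_norm_unit {d} (j : 'I_d) : sqr_norm (lattice_unit j) = 1.
Proof.
by rewrite /sqr_norm (bigD1 j) //= big1 => [|i /negPf ij]; rewrite mxE ?eqxx ?ij //.
Qed.

Lemma dot_unit {d} (n : lattice d) j :
  \sum_(i < d) n 0 i * lattice_unit j 0 i = n 0 j.
Proof.
rewrite (bigD1 j) //= big1 => [|i /negPf ij]; rewrite mxE ?eqxx ?ij ?mulr0 //.
by rewrite mulr1 addr0.
Qed.

Lemma sqr_normN {d} (n : lattice d) : sqr_norm (- n) = sqr_norm n.
Proof. by apply: eq_bigr => j _; rewrite mxE sqrrN. Qed.

Lemma sqr_norm_ge1 {d} (n : lattice d) : n != 0 -> 1 <= sqr_norm n.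
Proof.
move=> n0; rewrite -gtz0_ge1 lt_def sumr_ge0 ?andbT => [|j _]; last exact: sqr_ge0.
apply: contra n0 => /eqP/psumr_eq0P h; apply/eqP/rowP => j; apply/eqP.
by rewrite mxE -sqrf_eq0 h // => i _; exact: sqr_ge0.
Qed.

(** The value at the origin is 0^-1 = 0. It enters the estimates only through
    the Laplacian at the neighbours of the origin, which grows as this value
    decreases. *)
Definition weight (R : realType) {d} (n : lattice d) : R := (lattice_norm R n ^+ 2)^-1.

(** Summing [weight_second_difference] over the directions gives
    (2d - 32) / (r (r + 1)) with r = |n|^2 >= 1. As r + 1 <= 2r, this is at
    least (d - 16) / r^2, hence at least (d/2) / r^2 when d >= 32. *)
Lemma laplacian_weight_ge {R : realType} {d} (n : lattice d) :
  (32 <= d)%N -> n != 0 -> d%:R / 2 * weight R n ^+ 2 <= laplacian (weight R) n.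
Proof.
move=> d32 n0; have r1 := sqr_norm_ge1 n n0; set r := sqr_norm n in r1.
apply: (@le_trans _ _ (\sum_(j < d) (2 / (r%:~R * (r%:~R + 1))
     - 32 * (n 0 j)%:~R ^+ 2 / (r%:~R ^+ 2 * (r%:~R + 1))))); last first.
  apply: ler_sum => j _; rewrite /weight !lattice_norm_sqr !sqr_normD sqr_normN.
  rewrite sqr_norm_unit dot_unit.
  have -> : \sum_(i < d) n 0 i * (- lattice_unit j) 0 i = - n 0 j.
    by rewrite -(dot_unit n j) -sumrN; apply: eq_bigr => i _; rewrite !mxE mulrN.
  rewrite -/r mulrN; apply: weight_second_difference => //.
  rewrite /r /sqr_norm (bigD1 j) //= lerDl sumr_ge0 // => i _; exact: sqr_ge0.
rewrite sumrB sumr_const card_ord -[X in X - _]mulr_natl -mulr_suml -mulr_sumr.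
have -> : \sum_(j < d) (n 0 j)%:~R ^+ 2 = r%:~R :> R.
  by rewrite /r /sqr_norm rmorph_sum; apply: eq_bigr => j _; rewrite rmorphXn.
rewrite /weight lattice_norm_sqr -/r.
have : 32 <= d%:R :> R by rewrite (ler_nat _ 32).
have {r1} : 1 <= r%:~R :> R by rewrite (ler_int _ 1).
move: (r%:~R : R) (d%:R : R) => {}r D r1 D32.
have r0 : 0 < r by lra.
have rN0 : r != 0 /\ r + 1 != 0 by rewrite !gt_eqF //; lra.
rewrite -subr_ge0 (_ : _ - _ = ((2 * D - 32) * r - D / 2 * (r + 1)) / (r ^+ 2 * (r + 1))).
  apply: divr_ge0; last by rewrite mulr_ge0 ?sqr_ge0 //; lra.
  by have := mulr_ge0 (_ : 0 <= D - 32) (_ : 0 <= r - 1); nra.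
by field; case: rN0 => -> ->.
Qed.

(** * The two bounds on the Rellich constant *)

Lemma rellich_sums {R : realType} {d} (u : lattice d -> R[i]) (A : {fset lattice d}) :
  neighbours_in [set n | u n != 0] A ->
  rellich_energy u = \sum_(n <- A) normc (discrete_laplacian u n) ^+ 2 /\
  rellich_weighted_sum u = \sum_(n <- A) weight R n ^+ 2 * normc (u n) ^+ 2.
Proof.
move=> uA; have u0 m : ~ m \in A -> u m = 0.
  by move=> mA; apply: contra_notP mA => /eqP/uA[].
split.
  apply: fsbigTE => n /negP nA.
  rewrite /discrete_laplacian big1 ?normc0 ?expr0n // => j _.
  have nb m : u m != 0 -> n = m + lattice_unit j \/ n = m - lattice_unit j -> False.
    by move=> /uA[_ /(_ j)[pA mA]] [] nm; apply: nA; rewrite nm.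
  rewrite u0 // mulr0 sub0r.
  have -> : u (n - lattice_unit j) = 0.
    by apply: contrapT => /eqP/nb; apply; left; rewrite subrK.
  have -> : u (n + lattice_unit j) = 0.
    by apply: contrapT => /eqP/nb; apply; right; rewrite addrK.
  by rewrite !oppr0 addr0.
rewrite /rellich_weighted_sum (@fsbigTE _ _ _ _ A) => [|n /negP nA].
  by apply: eq_bigr => n _; rewrite mulrC /weight exprVn -exprM.
by rewrite u0 // normc0 expr0n mul0r.
Qed.

Lemma rellich_inequality {R : realType} {d} : (32 <= d)%N ->
  rellich_admissible d (16^-1 * d%:R ^+ 2 : R).
Proof.
move=> d32 u fu u0; have [A uA] := neighbours_in_fset _ fu.
have [-> ->] := rellich_sums u A uA.
pose f n := normc (u n) ^+ 2 : R.
have fA : neighbours_in [set n | f n != 0] A.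
  by move=> n fn; apply: uA; apply: contra_neq fn => un; rewrite /f un normc0 expr0n.
(* t = d/4 maximizes t d/2 - t^2. *)
pose t : R := d%:R / 4.
have w0 n : 0 <= weight R n by rewrite invr_ge0 sqr_ge0.
apply: (@le_trans _ _ (\sum_(n <- A) (t * (weight R n * laplacian f n)
                                      - t ^+ 2 * (weight R n ^+ 2 * f n)))); last first.
  apply: ler_sum => n _.
  have := sqr_normc_laplacian_ge u (t * weight R n) n.
  rewrite exprMn -!mulrA; apply.
  by rewrite !mulr_ge0 ?invr_ge0 ?sqr_ge0.
rewrite sumrB -!mulr_sumr laplacian_self_adjoint // -subr_ge0 !mulr_sumr -!sumrB.
apply: sumr_ge0 => n _.
have [->|n0] := eqVneq n 0; first by rewrite /f u0 normc0 expr0n !mulr0 !subr0.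
have := ler_wpM2r (sqr_ge0 _ : 0 <= f n) (laplacian_weight_ge n d32 n0).
rewrite -(ler_pM2l (_ : 0 < t)); last by rewrite divr_gt0 ?ltr0n // (leq_trans _ d32).
rewrite /t -/(f n); set L := _ * f n; set W := weight R n ^+ 2; set F := f n.
lra.
Qed.

(** Summed over the lattice, each of the d directions in
    [sqr_normc_laplacian_le] contributes 2 + 1 + 1 translated copies of the
    squared l^2 norm. *)
Lemma rellich_energy_le {R : realType} {d} (u : lattice d -> R[i]) :
  finitely_supported u ->
  rellich_energy u <= (4 * d%:R) ^+ 2 * \sum_(n \in [set: lattice d]) normc (u n) ^+ 2.
Proof.
move=> fu; have [A uA] := neighbours_in_fset _ fu.
have [-> _] := rellich_sums u A uA.
pose f n := normc (u n) ^+ 2 : R.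
have fA : neighbours_in [set n | f n != 0] A.
  by move=> n fn; apply: uA; apply: contra_neq fn => un; rewrite /f un normc0 expr0n.
rewrite (@fsbigTE _ _ _ _ A) => [|n /negP nA]; last first.
  by apply: contra_notP nA => /eqP/fA[].
apply: le_trans (ler_sum _ (fun n _ => sqr_normc_laplacian_le u n)) _.
rewrite -mulr_sumr exchange_big /=.
have shifts j : \sum_(n <- A) f (n + lattice_unit j) = \sum_(n <- A) f n /\
                \sum_(n <- A) f (n - lattice_unit j) = \sum_(n <- A) f n.
  have [] := sum_shifts A f (fun=> 1) j fA.
  by rewrite -!mulr_sumr !mul1r.
under eq_bigr => j _.
  rewrite 2!big_split /= -mulr_sumr; have [-> ->] := shifts j; over.
rewrite sumr_const card_ord -mulr_natl -/(f _).
by rewrite le_eqVlt; apply/orP; left; apply/eqP; rewrite /f; ring.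
Qed.

Theorem corollary1p6 (R : realType) :
  exists (c1 c2 : R) (N : nat),
    [/\ 0 < c1, 0 < c2, (0 < N)%N &
      forall d : nat, (N <= d)%N ->
        c1 * d%:R ^+ 2 <= rellich_constant R d <= c2 * d%:R ^+ 2].
Proof.
exists 16^-1, 16, 32%N; split; rewrite ?invr_gt0 ?ltr0n // => d d32.
have d0 : (0 < d)%N by rewrite (leq_trans _ d32).
have [adm max] := rellich_constant_max R d0.
rewrite max /=; last exact: rellich_inequality.
pose e : lattice d := lattice_unit (Ordinal d0).
pose v : lattice d -> R[i] := fun n => (n == e)%:R.
have v1 n : n != e -> v n = 0 by rewrite /v => /negPf ->.
have ve : normc (v e) ^+ 2 = 1 by rewrite /v eqxx normc1 expr1n.
have ne : lattice_norm R e ^+ 2 = 1 by rewrite lattice_norm_sqr sqr_norm_unit.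
have fv : finitely_supported v.
  apply: (@sub_finite_set _ _ [set e]%classic) => // n /=.
  by apply: contra_neqP => /eqP; apply: v1.
have v0 : v 0 = 0.
  apply: v1; apply: contra_eq_neq ne => <-; rewrite lattice_norm_sqr /sqr_norm.
  by rewrite big1 => [|j _]; rewrite ?mxE // mulr0z eq_sym oner_eq0.
have single (g : lattice d -> R) : (forall n, n != e -> g n = 0) ->
    \sum_(n \in [set: lattice d]) g n = g e.
  move=> g0; rewrite -(fsbig_widen [set e]%classic) ?fsbig_set1 // => n [_ /= /eqP].
  exact: g0.
have := le_trans (adm v fv v0) (rellich_energy_le v fv).
rewrite /rellich_weighted_sum !single => [|n /v1 ->|n /v1 ->].
- have -> : (4 * d%:R) ^+ 2 = 16 * d%:R ^+ 2 :> R by ring.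
  by rewrite ve (exprM _ 2 2) ne expr1n divr1 !mulr1.
- by rewrite normc0 expr0n.
- by rewrite normc0 expr0n mul0r.
Qed.
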